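(* Let $X$ be a compact metrizable space which is an absolute neighborhood retract (ANR). Then $X$ is $e$-open.
   Context: ''Space'' means compact metrizable space and ''map'' means continuous function. A space pair is a pair $(Y,Z)$ where $Y$ is a space and $Z\subseteq Y$ is a closed subspace. For spaces $X,Z$, $X^Z$ denotes the set of maps from $Z$ to $X$ with the topology of uniform convergence (equivalently, the compact-open topology). For a space pair $(Y,Z)$, $X^{Z\uparrow Y}\subseteq X^Z$ denotes the set of maps from $Z$ to $X$ which extend to a map from $Y$ to $X$. A space $X$ is $e$-open if, for every space pair $(Y,Z)$, the set $X^{Z\uparrow Y}$ is open in $X^Z$. A compact metrizable space $X$ is an ANR if, for every space pair $(Y,Z)$, every map from $Z$ to $X$ extends to a continuous map from some neighborhood of $Z$ in $Y$ to $X$. *)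

(* Defs.v *)
From HB Require Import structures.
From mathcomp Require Import all_boot all_order all_algebra.
From mathcomp Require Import all_classical all_reals topology function_spaces.

Set Implicit Arguments.
Unset Strict Implicit.
Unset Printing Implicit Defensive.

Local Open Scope classical_set_scope.

(* A compact metrizable space is rendered as a [metricType R] whose full set is
   compact; it may be empty. A closed subspace [Z : set Y] is used through its
   coercion to a type with the subspace topology, so [continuousType Z X] is
   the set of maps from Z to X. *)

(* Gives [continuousType Z X] the topology of uniform convergence. *)
Import ArrowAsUniformType.

(* X^{Z\uparrow Y} as a subset of X^Z *)
Definition extendable_maps (R : realType) (X Y : metricType R) (Z : set Y) :
    set (continuousType Z X) :=
  [set f : continuousType Z X |
     exists F : continuousType Y X, forall z : Z, F (\val z) = f z].

Arguments extendable_maps {R} X {Y} Z.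

Definition e_open (R : realType) (X : metricType R) : Prop :=
  forall (Y : metricType R) (Z : set Y),
    compact [set: Y] -> closed Z -> open (extendable_maps X Z).

(* A neighborhood of Z is any set whose interior contains Z. *)
Definition is_ANR (R : realType) (X : metricType R) : Prop :=
  forall (Y : metricType R) (Z : set Y),
    compact [set: Y] -> closed Z ->
    forall f : continuousType Z X,
      exists (U : set Y) (g : continuousType U X),
        Z `<=` U° /\
        forall (z : Z) (u : U), \val u = \val z -> g u = f z.

(* Main.v *)
Require Import Defs.
From HB Require Import structures.
From mathcomp Require Import all_boot all_order all_algebra.
From mathcomp Require Import all_classical all_reals topology function_spaces.
From mathcomp Require Import interval_inference num_normedtype.

Set Implicit Arguments.
Unset Strict Implicit.
Unset Printing Implicit Defensive.

Import Order.TTheory GRing.Theory Num.Theory.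
Local Open Scope classical_set_scope.
Local Open Scope ring_scope.

(** Openness is tested along sequences, and a uniformly convergent sequence of
    maps is a single map on a cylinder.

    Let F : Y -> X restrict to f on Z, and let maps g_n : Z -> X converge
    uniformly to f. In the compact metric space Y x (N u {oo}), consider the
    closed set consisting of Z x N together with the whole limit slice
    Y x {oo}. The map equal to g_n on Z x {n} and to F on Y x {oo} is
    continuous there, precisely because the convergence is uniform
    ([glue_continuous]). As X is an ANR, this map extends to a neighborhood U of
    the closed set. U contains the compact slice Y x {oo}, hence, by the tube
    lemma, also the slices Y x {n} for all large n; restricting the extension to
    such a slice extends g_n to Y ([extendable_maps_seq]).

    Were the set of extendable maps not a neighborhood of f, some g_n at distance
    less than 1/(n+1) from f would fail to extend for every n, against the
    above. *)

(** * The metric on a product and the convergent sequence *)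

Section prod_metric.
Context {R : realType} (U V : metricType R).

Let dist (p q : U * V) : R := Num.max (mdist p.1 q.1) (mdist p.2 q.2).

Let dist_ge0 p q : 0 <= dist p q.
Proof. by rewrite le_max mdist_ge0. Qed.

Let dist_positivity p q : dist p q = 0 -> p = q.
Proof.
case: p q => [a b] [c d] /= pq0.
have /andP[ac bd] : (mdist a c <= 0) && (mdist b d <= 0).
  by rewrite -ge_max -pq0 lexx.
by congr pair; apply: mdist_positivity; apply/eqP;
  rewrite eq_le mdist_ge0 ?ac ?bd.
Qed.

Let ball_dist p e : ball p e = [set q | dist p q < e].
Proof.
by apply/seteqP; split=> q; rewrite /ball/= /prod_ball !ballEmdist/= gt_max
  => /andP.
Qed.

HB.instance Definition _ := @PseudoMetric_isMetric.Build R (U * V)%type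
  dist dist_ge0 dist_positivity ball_dist.

End prod_metric.

(** The space N u {oo}, with [None] as the point at infinity; [R] is the field in
    which its distances take values. *)
Definition nat_infty (R : realType) : Type := option nat.

Section nat_infty_metric.
Context {R : realType}.
Local Notation W := (nat_infty R).

HB.instance Definition _ := Choice.on W.

Let height (a : W) : R := if a is Some n then n.+1%:R^-1 else 0.

Let height_ge0 a : 0 <= height a.
Proof. by case: a => //= n; rewrite invr_ge0. Qed.

(** The ultrametric max(1/(n+1), 1/(m+1)) off the diagonal gives the same topology
   as |1/(n+1) - 1/(m+1)|, and makes it immediate that [Some n] is isolated. *)
Let dist (a b : W) : R := if a == b then 0 else Num.max (height a) (height b).

Let distxx a : dist a a = 0.
Proof. by rewrite /dist eqxx. Qed.

Let dist_positivity a b : dist a b = 0 -> a = b.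
Proof.
rewrite /dist; case: eqVneq => //= ab /eqP; rewrite eq_le ge_max => /andP[].
by case: a b ab => [n|] [m|] //= _ /andP[h1 h2] _; exfalso; move: h1 h2;
  rewrite !invr_le0 !lern0.
Qed.

Let dist_sym a b : dist a b = dist b a.
Proof. by rewrite /dist eq_sym maxC. Qed.

Let dist_triangle b a c : dist a c <= dist a b + dist b c.
Proof.
have [->|ab] := eqVneq a b; first by rewrite distxx add0r.
have [<-|bc] := eqVneq b c; first by rewrite distxx addr0.
rewrite /dist (negbTE ab) (negbTE bc); case: ifP => _.
  by rewrite addr_ge0// le_max height_ge0.
by rewrite ge_max ler_wpDr ?ler_wpDl ?le_max ?height_ge0 ?lexx ?orbT.
Qed.

HB.instance Definition _ :=
  @isMetric.Build R W dist distxx dist_positivity dist_sym dist_triangle.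

Lemma nbhs_Some n : nbhs (Some n : W) [set Some n : W].
Proof.
apply/(@metricType_numDomainType.nbhs_mdistP R W); exists n.+1%:R^-1 => /=.
  by rewrite invr_gt0.
move=> a /=; rewrite /mdist/= /dist; case: eqVneq => [->//|_].
by rewrite gt_max ltxx.
Qed.

Lemma nbhs_None (A : set W) : nbhs (None : W) A <->
  A None /\ \forall n \near \oo, A (Some n).
Proof.
rewrite -(@metricType_numDomainType.nbhs_nbhs_mdist R W); split.
  move=> [e /= e0 eA]; split; first by apply: eA => /=; rewrite mdistxx.
  have := near_infty_natSinv_lt (PosNum e0); apply: filterS => n /= ne.
  apply: eA => /=; rewrite /mdist/= /dist/=.
  by rewrite gt_max e0.
move=> [A0 [N _ NA]]; exists N.+1%:R^-1 => /=; first by rewrite invr_gt0.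
case=> [n|//] /=; rewrite /mdist/= /dist/= gt_max => /andP[_].
by rewrite ltf_pV2 ?posrE// ltr_nat => /ltnW /NA.
Qed.

(** A neighborhood of infinity misses only finitely many points, which are then
    handled one at a time. *)
Lemma compact_nat_infty : compact [set: W].
Proof.
apply/compact_near_coveringP => J F P FF cov.
have [[A B] /= [/nbhs_None[A0 [N _ NA]] FB] ABP] := cov None I.
have small n : \forall i \near F, P i (Some n : W).
  have [[C D] /= [nC FD] CDP] := cov (Some n) I.
  by apply: filterS FD => i Di; apply: (CDP (Some n, i)); split => //=;
    exact: (@nbhs_singleton W).
have {small} lt_small : \forall i \near F, forall n, (n < N)%N -> P i (Some n : W).
  elim: N {NA} => [|N IH]; first exact: nearW.
  by apply: filterS2 IH (small N) => i iN PN n; rewrite ltnS leq_eqVlt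
    => /predU1P[->|/iN].
apply: filterS2 FB lt_small => i Bi iN [n|] _; last exact: (ABP (None, i)).
have [/iN//|/NA An] := ltnP n N; exact: (ABP (Some n, i)).
Qed.

End nat_infty_metric.

(** * Gluing a sequence of maps to its limit *)

Lemma nbhs_set_val (T : topologicalType) (A : set T) (x : A) (B : set A) :
  nbhs x B <-> exists2 V, nbhs (\val x) V & forall y : A, V (\val y) -> B y.
Proof.
split.
  move=> [_ [[V oV <-] Vx] VB]; exists V; last exact: VB.
  by apply: open_nbhs_nbhs.
move=> [V xV VB].
have : nbhs x (set_val @^-1` V) by exact: initial_continuous.
exact: filterS.
Qed.

(** The part of the cylinder over [Y] on which a sequence of maps on [Z] and a
    limit map on [Y] prescribe values. *)
Definition limit_cylinder (R : realType) (Y : Type) (Z : set Y) :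
    set (Y * nat_infty R) :=
  [set p | if p.2 is Some _ then Z p.1 else True].

(** Points at infinity all belong to the set, and the slices at finite levels are
    open, so closedness is inherited slice by slice from [Z]. *)
Lemma closed_limit_cylinder (R : realType) (Y : topologicalType) (Z : set Y) :
  closed Z -> closed (limit_cylinder (R := R) Z).
Proof.
move=> cZ; rewrite -openC openE => -[y [n|]] /= nZ; last by case: nZ.
exists (~` Z, [set (Some n : nat_infty R)]) => /=.
  split; last exact: nbhs_Some.
  by apply: open_nbhs_nbhs; split => //; exact: closed_openC.
by move=> [y' w] /= [nZy' ->].
Qed.

(** A total function on the cylinder, so that no membership proof occurs in its
    argument; off [limit_cylinder Z] it takes the default value [F p.1]. *)
Definition glue (R : realType) (X Y : Type) (Z : set Y) (F : Y -> X)
    (g : nat -> Z -> X) (p : Y * nat_infty R) : X :=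
  if p.2 is Some n then
    if pselect (Z p.1) is left Zy then g n (exist _ p.1 (mem_set Zy)) else F p.1
  else F p.1.

Lemma glueS (R : realType) (X Y : Type) (Z : set Y) (F : Y -> X)
    (g : nat -> Z -> X) n (z : Z) :
  glue F g (\val z, Some n : nat_infty R) = g n z.
Proof.
case: z => z Zz; rewrite /glue /=; case: pselect => [Zz'|].
  by congr (g n); exact: val_inj.
by move/set_mem : (Zz).
Qed.

(** Near (y, n) only the level n matters, where continuity is that of [g n]. Near
    (y, oo), a point (y', n) has g_n y' close to F y' by uniform convergence, and
    F y' is close to F y. *)
Lemma glue_continuous (R : realType) (X Y : metricType R) (Z : set Y)
    (F : Y -> X) (g : nat -> Z -> X) :
  continuous F -> (forall n, continuous (g n)) ->
  (forall e : R, 0 < e ->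
     \forall n \near \oo, forall z : Z, ball (F (\val z)) e (g n z)) ->
  continuous (glue F g \o set_val : limit_cylinder (R := R) Z -> X).
Proof.
move=> cF cg gF -[[y [n|]] yZ] B /=.
  have Zy : y \in Z by move/set_mem : (yZ) => /mem_set.
  pose z : Z := exist _ y Zy.
  rewrite [_ (set_val _)](glueS R F g n z) => /(cg n z)/nbhs_set_val[V Vy VB].
  apply/nbhs_set_val; exists (V `*` [set (Some n : nat_infty R)]).
    by exists (V, [set (Some n : nat_infty R)]) => //; split=> //; exact: nbhs_Some.
  move=> [[y' w] y'Z] /= [Vy' wn]; subst w.
  have Zy' : y' \in Z by move/set_mem : (y'Z) => /mem_set.
  have := VB (exist _ y' Zy') Vy'; rewrite /preimage/=.
  by rewrite -(glueS R F g n (exist _ y' Zy')).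
move=> /nbhs_ballP[e /= e0 eB]; rewrite /glue/= in eB.
have e20 : 0 < e / 2 by rewrite divr_gt0.
pose V := F @^-1` ball (F y) (e / 2).
(* the levels at which [g] is uniformly close to [F] *)
pose N : set (nat_infty R) := [set w |
  if w is Some n then forall z : Z, ball (F (\val z)) (e / 2) (g n z) else True].
apply/nbhs_set_val; exists (V `*` N).
  exists (V, N) => //.
  split => /=; first by apply: cF; exact: nbhsx_ballx.
  by apply/nbhs_None; split => //; exact: gF.
move=> [[y' [n|]] y'Z] /= [By' gn]; apply: eB.
  have Zy' : y' \in Z by move/set_mem : (y'Z) => /mem_set.
  rewrite [glue _ _ _](glueS R F g n (exist _ y' Zy')).
  by rewrite [e]splitr; exact: ball_triangle By' (gn (exist _ y' Zy')).
by apply: le_ball By'; rewrite ler_pdivrMr// ler_peMr ?ler1n// ltW.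
Qed.

(** * Extending all late terms of the sequence *)

Lemma tube_lemma (Y W : topologicalType) (w : W) (U : set (Y * W)) :
  compact [set: Y] -> (forall y, nbhs ((y, w) : (Y * W)%type) U) ->
  \forall w' \near w, forall y, U (y, w').
Proof.
move=> /compact_near_coveringP cY yU.
have cov y : [set: Y] y -> \forall y' \near y & w' \near w, U (y', w').
  by move=> _; have := yU y; apply: filterS => -[].
have := cY W (nbhs w) (fun w' y => U (y, w')) (nbhs_filter w) cov.
by apply: filterS => w' h y; exact: (h y I).
Qed.

(** The ANR property applied to the glued map: its extension is defined on the
    slices Y x {n} for all large n. *)
Lemma extendable_maps_seq (R : realType) (X Y : metricType R) (Z : set Y)
    (F : continuousType Y X) (g : nat -> continuousType Z X) :
  is_ANR X -> compact [set: Y] -> closed Z ->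
  (forall e : R, 0 < e ->
     \forall n \near \oo, forall z : Z, ball (F (\val z)) e (g n z)) ->
  \forall n \near \oo, extendable_maps X Z (g n).
Proof.
move=> anrX cY cZ gF.
have ch := glue_continuous (@cts_fun _ _ F) (fun n => @cts_fun _ _ (g n)) gF.
have cYW : compact [set: (Y * nat_infty R)%type].
  by rewrite -setXTT; apply: compact_setX => //; exact: compact_nat_infty.
have [U [k [ZU kh]]] := anrX _ _ cYW (closed_limit_cylinder (R:=R) cZ) (mkcts ch).
have /(tube_lemma cY)/nbhs_None[_] :
    forall y, nbhs ((y, None) : (Y * nat_infty R)%type) U.
  by move=> y; exact: ZU.
apply: filterS => n Un.
(* the inclusion of the slice at level n *)
pose u y : U := exist _ (y, Some n : nat_infty R) (mem_set (Un y)).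
have cu : continuous u.
  move=> y B /nbhs_set_val[V [[A N] /= [yA nN] ANV] VB].
  apply: filterS yA => y' Ay'; apply: VB; apply: ANV; split => //=.
  exact: (@nbhs_singleton (nat_infty R)).
have cku : continuous (k \o u).
  by move=> y; apply: continuous_comp; [exact: cu|exact: cts_fun].
exists (mkcts cku) => z /=.
have zZ : (\val z, Some n : nat_infty R) \in limit_cylinder (R := R) Z.
  by apply/mem_set => /=; exact: set_valP.
pose zn : limit_cylinder (R := R) Z := exist _ (\val z, Some n) zZ.
rewrite /mkcts/= (kh zn)//=.
exact: glueS.
Qed.

Import ArrowAsUniformType.

Lemma nbhs_continuous_uniform (R : realType) (Y : topologicalType)
    (X : metricType R) (f : continuousType Y X) (A : set (continuousType Y X)) :
  (exists2 e : R, 0 < e & forall g : continuousType Y X,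
    (forall y, ball (f y) e (g y)) -> A g) -> nbhs f A.
Proof.
move=> [e e0 eA].
pose fun_of (g : continuousType Y X) : arrow_uniform_type Y X := g.
have : nbhs f (fun_of @^-1` ball (fun_of f) e).
  exact: (@initial_continuous _ _ fun_of) (nbhsx_ballx _ _ e0).
by apply: filterS => g; exact: eA.
Qed.

Theorem proposition3p2 (R : realType) (X : metricType R)
  (cX : compact [set: X]%classic) (anrX : is_ANR X) : e_open X.
Proof.
move=> Y Z cY cZ; rewrite openE => f [F Ff].
apply: nbhs_continuous_uniform; apply: contrapT => noball.
have bad n : exists g : continuousType Z X,
    (forall z, ball (f z) n.+1%:R^-1 (g z)) /\ ~ extendable_maps X Z g.
  apply: contrapT => /forallNP nog; apply: noball.
  exists n.+1%:R^-1; first by rewrite invr_gt0.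
  by move=> g fg; apply: contrapT => ng; exact: (nog g).
have [g gP] := choice bad.
suff [N _ /(_ N)] : \forall n \near \oo, extendable_maps X Z (g n).
  by move=> /(_ (leqnn N)); exact: (gP N).2.
apply: (extendable_maps_seq (F := F)) => // e e0.
have := near_infty_natSinv_lt (PosNum e0); apply: filterS => n /= ne z.
by rewrite Ff; apply: le_ball ((gP n).1 z); exact: ltW.
Qed.
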